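(* Let $\mathcal{C}\subseteq\mathbb{F}(\!(D)\!)^n$ be a strongly MDS $(n,n-1,\delta)$-code with basic parity check matrix $H\in\mathbb{F}[D]^{1\times n}$, put $M:=\lfloor\frac{\delta}{n-1}\rfloor+\delta$, and let $H^c_M\in\mathbb{F}^{(M+1)\times(M+1)n}$ be its $M$-th sliding parity check matrix. Let $v\in\mathcal{C}$ (the sent codeword) and $\hat v=v+\epsilon\in\mathbb{F}(\!(D)\!)^n$ (the received word), where $\epsilon\in\mathbb{F}(\!(D)\!)^n$ is the error vector, and assume that $v$ and $\hat v$ both have delay $\ge 0$. Assume that any sliding window of length $(M+1)n$ contains at most $\frac{M+1}{2}$ errors, i.e. $$\mathrm{wt}(\epsilon_{[j,j+M]})\le\frac{M+1}{2}\quad\text{for all } j\ge 0.$$ Then the following algorithm decodes $\hat v$ correctly, i.e. for each $j=0,1,2,\dots$ we have $\hat v_{[0,j]}=v_{[0,j]}$ after the $j$-th cycle (here $\hat v$ denotes the current, successively modified word): Put $j:=-1$. Step 1: Put $j:=j+1$. Step 2: Compute the syndrome vector $S:=(\hat vH^{\mathsf T})_{[j,j+M]}\in\mathbb{F}^{M+1}$. Step 3: From $S$ determine the unique $\eta_0\in\mathbb{F}^n$ such that $S=\eta(H^c_M)^{\mathsf T}$ for some $\eta=(\eta_0,\dots,\eta_M)\in\mathbb{F}^{(M+1)n}$ (with $\eta_i\in\mathbb{F}^n$) satisfying $\mathrm{wt}(\eta)\le\frac{M+1}{2}$. Step 4: Put $\hat v:=\hat v-\eta_0D^j$. Step 5: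 Go to Step 1. (In particular, in each cycle an $\eta_0$ as required in Step 3 exists and is unique.)
   Context: Let $\mathbb{F}$ be a finite field, $\mathbb{F}[D]$ the polynomial ring and $\mathbb{F}(\!(D)\!)$ the field of formal Laurent series $\sum_{j\ge l}a_jD^j$. For $1\le k<n$, a convolutional code of rate $k/n$ is a set $\mathcal{C}=\{uG\mid u\in\mathbb{F}(\!(D)\!)^k\}\subseteq\mathbb{F}(\!(D)\!)^n$ with $G\in\mathbb{F}[D]^{k\times n}$ of rank $k$; $G$ is called a generator matrix of $\mathcal{C}$. A polynomial matrix is basic if it has a polynomial right inverse; a polynomial generator matrix is minimal if the sum of its row degrees is minimal among all polynomial generator matrices of $\mathcal{C}$. Every code has a generator matrix that is both minimal and basic, and the degree $\delta$ of $\mathcal{C}$ is the sum of the row degrees of such a matrix. A code of rate $k/n$ and degree $\delta$ is called an $(n,k,\delta)$-code. A parity check matrix is a matrix $H\in\mathbb{F}[D]^{(n-k)\times n}$ with $\mathcal{C}=\{v\in\mathbb{F}(\!(D)\!)^n\mid vH^{\mathsf T}=0\}$; throughout it is taken to be basic. Writing $H=\sum_{j=0}^{\mu}H_jD^j$ with $H_j:=0$ for $j>\mu$, the $j$-th sliding parity check matrix is the block lower triangular matrix $H^c_j\in\mathbb{F}^{(j+1)(n-k)\times(j+1)n}$ whose $(a,b)$ block, $0\le b\le a\le j$, is $H_{a-b}$, all blocks with $b>a$ being zero. For $w\in\mathbb{F}^N$, $\mathrm{wt}(w)$ is the number of nonzero coordinates. For $v=\sum_j v_jD^j$ nonzero the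 delay of $v$ is $\min\{j\mid v_j\ne0\}$ (and $\infty$ for $v=0$), and $v_{[m,M]}:=(v_m,\dots,v_M)$. For $j\ge 0$ the $j$th column distance of $\mathcal{C}$ is $d^c_j:=\min\{\mathrm{wt}(v_{[0,j]})\mid v\in\mathcal{C},\ \text{delay of }v\text{ equals }0\}$. An $(n,k,\delta)$-code is strongly MDS if $d^c_M=(n-k)\left(\lfloor\frac{\delta}{k}\rfloor+1\right)+\delta+1$ for $M=\lfloor\frac{\delta}{k}\rfloor+\lceil\frac{\delta}{n-k}\rceil$. For $k=n-1$ this means $d^c_M=M+2$ with $M=\lfloor\frac{\delta}{n-1}\rfloor+\delta$. *)

(* Defs.v *)
From HB Require Import structures.
From mathcomp Require Import all_boot all_order all_algebra.
From mathcomp Require Import boolp classical_sets functions cardinality fsbigop.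
From mathcomp Require Import constructive_ereal zify.

Set Implicit Arguments.
Unset Strict Implicit.
Unset Printing Implicit Defensive.

Import Order.TTheory GRing.Theory Num.Theory.
Local Open Scope classical_set_scope.
Local Open Scope ring_scope.

(* A Laurent series \sum_j f_j D^j is its coefficient function f : int -> R,
   required to vanish below some l. *)
Section Laurent.
Variable R : comNzRingType.

Definition bounded_below : {pred int -> R} :=
  fun f => `[< exists l : int, forall j, j < l -> f j = 0 >].

Record laurent := Laurent {
  lcoef :> int -> R;
  lcoefP : lcoef \in bounded_below }.

HB.instance Definition _ := [isSub for lcoef].
HB.instance Definition _ := [Choice of laurent by <:].

Fact bounded_below_zmod_closed : zmod_closed bounded_below.
Proof.
split=> [|f g /asboolP[l fl] /asboolP[m gm]]; apply/asboolP.
  by exists 0.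
exists (Order.min l m) => j; rewrite lt_min => /andP[jl jm].
by rewrite [LHS](_ : _ = f j - g j) // fl // gm // subrr.
Qed.

HB.instance Definition _ := GRing.isZmodClosed.Build (int -> R) bounded_below
  bounded_below_zmod_closed.
HB.instance Definition _ := [SubChoice_isSubZmodule of laurent by <:].

Lemma laurentP (f g : laurent) : (forall j, f j = g j) <-> f = g.
Proof. by split=> [fg|-> //]; apply/val_inj/funext. Qed.

Lemma laurent_bound (f : laurent) : exists l : int, forall j, j < l -> f j = 0.
Proof. exact/asboolP/lcoefP. Qed.

Lemma lcoef0 j : (0 : laurent) j = 0. Proof. by []. Qed.
Lemma lcoefD (f g : laurent) j : (f + g) j = f j + g j. Proof. by []. Qed.
Lemma lcoefN (f : laurent) j : (- f) j = - f j. Proof. by []. Qed.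

(* For bounded-below f and g only finitely many terms are nonzero, so the
   finitely supported sum below is the Cauchy product. *)
Definition conv (f g : int -> R) : int -> R :=
  fun j => \sum_(i \in [set: int]) f i * g (j - i).

Let trunc (l : int) N (f : int -> R) : {poly R} :=
  \poly_(i < N) f (l + i%:Z).

Let conv_lt (f g : int -> R) l m j : (forall i, i < l -> f i = 0) ->
  (forall i, i < m -> g i = 0) -> j < l + m -> conv f g j = 0.
Proof.
move=> fl gm jlm; apply: fsbig1 => i _.
have [il|li] := ltP i l; first by rewrite fl // mul0r.
rewrite gm ?mulr0 // ltrBlDr; apply: (lt_le_trans jlm).
by rewrite addrC lerD2l.
Qed.

Let convE (f g : int -> R) l m N (k : nat) : (forall i, i < l -> f i = 0) ->
  (forall i, i < m -> g i = 0) -> (k < N)%N ->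
  conv f g (l + m + k%:Z) = (trunc l N f * trunc m N g)`_k.
Proof.
move=> fl gm kN; rewrite coefM /conv.
pose r := [seq l + i%:Z | i <- index_iota 0 k.+1].
have r_uniq : uniq r by rewrite map_inj_uniq ?iota_uniq // => a b /addrI[].
rewrite (fsbigE r) //.
- rewrite big_map (eq_bigl xpredT) => [|i]; last exact: in_setT.
  rewrite big_mkord; apply: eq_bigr => -[i /=]; rewrite ltnS => ik _.
  rewrite !coef_poly (leq_ltn_trans ik kN).
  rewrite (leq_ltn_trans (leq_subr _ _) kN).
  by congr (_ * g _); lia.
- move=> i _ /negP ir; have [il|li] := ltP i l; first by rewrite fl // mul0r.
  rewrite gm ?mulr0 //; rewrite ltNge; apply/negP => mi; apply: ir.
  by apply/mapP; exists `|i - l|%N; [rewrite mem_index_iota|]; lia.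
Qed.

Fact conv_bounded (f g : laurent) : conv f g \in bounded_below.
Proof.
have [l fl] := laurent_bound f; have [m gm] := laurent_bound g.
by apply/asboolP; exists (l + m) => j; apply: conv_lt.
Qed.

Definition mull (f g : laurent) : laurent := Laurent (conv_bounded f g).

Fact poly_bounded (p : {poly R}) :
  (fun j : int => if j is Posz i then p`_i else 0) \in bounded_below.
Proof. by apply/asboolP; exists 0 => -[]. Qed.

Definition lpoly (p : {poly R}) : laurent := Laurent (poly_bounded p).

Let int_split (l j : int) : j < l \/ exists k : nat, j = l + k%:Z.
Proof.
have [|lj] := ltP j l; first by left.
by right; exists `|j - l|%N; lia.
Qed.

Fact mullC : commutative mull.
Proof.
move=> f g; have [l fl] := laurent_bound f; have [m gm] := laurent_bound g.
apply/laurentP => j; case: (int_split (l + m) j) => [jl|[k ->]] /=.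
  by rewrite (conv_lt fl gm) // (conv_lt gm fl) // addrC.
rewrite (convE fl gm (ltnSn k)) addrC [l + m]addrC addrC.
by rewrite (convE gm fl (ltnSn k)) mulrC.
Qed.

Let coefM_le (p p' q q' : {poly R}) k :
  (forall i, (i <= k)%N -> p`_i = p'`_i) ->
  (forall i, (i <= k)%N -> q`_i = q'`_i) -> (p * q)`_k = (p' * q')`_k.
Proof.
move=> pp' qq'; rewrite !coefM; apply: eq_bigr => -[i /= ik] _.
by rewrite pp' // qq' // leq_subr.
Qed.

Let trunc_conv f g l m N (k : nat) : (forall i, i < l -> f i = 0) ->
  (forall i, i < m -> g i = 0) -> (k < N)%N ->
  (trunc (l + m) N (conv f g))`_k = (trunc l N f * trunc m N g)`_k.
Proof. by move=> fl gm kN; rewrite coef_poly kN (convE fl gm kN). Qed.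

Fact mullA : associative mull.
Proof.
move=> f g h; have [l fl] := laurent_bound f; have [m gm] := laurent_bound g.
have [n hn] := laurent_bound h.
have fgb i : i < l + m -> conv f g i = 0 by exact: conv_lt.
have ghb i : i < m + n -> conv g h i = 0 by exact: conv_lt.
apply/laurentP => j; case: (int_split (l + m + n) j) => [jl|[k ->]] /=.
  by rewrite (conv_lt fgb hn) // (conv_lt fl ghb) // addrA.
rewrite (convE fgb hn (ltnSn k)) -[l + m + n]addrA (convE fl ghb (ltnSn k)).
set tf := trunc l _ f; set tg := trunc m k.+1 g; set th := trunc n _ h.
rewrite (@coefM_le _ tf _ (tg * th)) // => [|i ik]; last exact: trunc_conv.
rewrite (@coefM_le (trunc (l + m) _ _) (tf * tg) _ th) // => [|i ik].
  by rewrite mulrA.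
exact: trunc_conv.
Qed.

Fact mul1l : left_id (lpoly 1) mull.
Proof.
move=> f; have [l fl] := laurent_bound f.
have b1 (i : int) : i < 0 -> lpoly 1 i = 0 by case: i.
apply/laurentP => j; case: (int_split (0 + l) j) => [jl|[k ->]] /=.
  by rewrite (conv_lt b1 fl) // fl // -[l]add0r.
rewrite (convE b1 fl (ltnSn k)) (@coefM_le _ 1 _ (trunc l k.+1 f)) //.
  by rewrite mul1r coef_poly ltnSn add0r.
by move=> i ik; rewrite coef_poly ltnS ik add0r.
Qed.

Fact mullDl : left_distributive mull +%R.
Proof.
move=> f g h; have [l fl] := laurent_bound f; have [m gm] := laurent_bound g.
have [n hn] := laurent_bound h; pose p := Order.min l m.
have fp i : i < p -> f i = 0 by rewrite lt_min => /andP[/fl].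
have gp i : i < p -> g i = 0 by rewrite lt_min => /andP[_ /gm].
have fgp i : i < p -> (f + g) i = 0 by move=> ip; rewrite lcoefD fp // gp // addr0.
apply/laurentP => j; rewrite lcoefD /=.
case: (int_split (p + n) j) => [jl|[k ->]].
  by rewrite (conv_lt fp hn) // (conv_lt gp hn) // (conv_lt fgp hn) // addr0.
rewrite (convE fp hn (ltnSn k)) (convE gp hn (ltnSn k)) (convE fgp hn (ltnSn k)).
have -> : trunc p k.+1 (f + g) = trunc p k.+1 f + trunc p k.+1 g.
  by apply/polyP => i; rewrite coefD !coef_poly; case: ifP; rewrite ?addr0.
by rewrite mulrDl coefD.
Qed.

Fact onel_neq0 : lpoly 1 != 0.
Proof.
by apply/eqP => /laurentP /(_ 0) /=; rewrite coef1 => /eqP; rewrite oner_eq0.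
Qed.

HB.instance Definition _ := GRing.Zmodule_isComNzRing.Build laurent
  mullA mullC mul1l mullDl onel_neq0.

Lemma lcoefM (f g : laurent) j :
  (f * g) j = \sum_(i \in [set: int]) f i * g (j - i).
Proof. by []. Qed.

Lemma lcoef_poly (p : {poly R}) (i : nat) : lpoly p i = p`_i.
Proof. by []. Qed.

End Laurent.

Definition minimum {d} {T : porderType d} (x0 : T) (A : set T) : T :=
  xget x0 (A `&` lbound A).

Section Codes.
Variable F : fieldType.

Definition wt N (w : 'rV[F]_N) : nat := #|[pred i | w 0 i != 0]|.

Definition vcoef n (v : 'rV[laurent F]_n) (j : int) : 'rV[F]_n :=
  map_mx (fun f : laurent F => f j) v.

(* The window v_[m, m + l]: the last argument is an offset, not an endpoint. *)
Definition window n (v : 'rV[laurent F]_n) (m : int) (l : nat) :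
    'rV[F]_(\sum_(i < l.+1) n) :=
  \mxrow_(i < l.+1) vcoef v (m + i%:Z).

Definition delay n (v : 'rV[laurent F]_n) : \bar int :=
  minimum +oo%E [set j%:E | j in [set j : int | vcoef v j != 0]].

Definition basic k n (G : 'M[{poly F}]_(k, n)) : Prop :=
  exists X : 'M[{poly F}]_(n, k), G *m X = 1%:M.

(* The rank of a polynomial matrix is its rank over the field F(D). *)
Definition generator k n (C : set 'rV[laurent F]_n)
    (G : 'M[{poly F}]_(k, n)) : Prop :=
  \rank (map_mx (@tofrac {poly F}) G) = k /\
  C = [set u *m map_mx (@lpoly F) G | u in [set: 'rV[laurent F]_k]].

(* A zero row gets degree 0, but generator matrices have no zero row. *)
Definition row_degree k n (G : 'M[{poly F}]_(k, n)) (i : 'I_k) : nat :=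
  \max_(j < n) (size (G i j)).-1.

Definition row_degree_sum k n (G : 'M[{poly F}]_(k, n)) : nat :=
  \sum_(i < k) row_degree G i.

Definition minimal_generator k n (C : set 'rV[laurent F]_n)
    (G : 'M[{poly F}]_(k, n)) : Prop :=
  generator C G /\
  forall G' : 'M[{poly F}]_(k, n),
    generator C G' -> (row_degree_sum G <= row_degree_sum G')%N.

(* C is an (n, k, delta)-code. *)
Definition is_code n k delta (C : set 'rV[laurent F]_n) : Prop :=
  (1 <= k < n)%N /\
  exists G : 'M[{poly F}]_(k, n),
    [/\ minimal_generator C G, basic G & row_degree_sum G = delta].

Definition parity_check r n (C : set 'rV[laurent F]_n)
    (H : 'M[{poly F}]_(r, n)) : Prop :=
  basic H /\ C = [set v | v *m (map_mx (@lpoly F) H)^T = 0].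

Definition column_distance n (C : set 'rV[laurent F]_n) (j : nat) : nat :=
  minimum 0%N
    [set wt (window v 0 j) | v in [set v | C v /\ delay v = 0%:E]].

Definition ceil_div (a b : nat) : nat := (a %/ b + ~~ (b %| a))%N.

Definition strongly_MDS n k delta (C : set 'rV[laurent F]_n) : Prop :=
  is_code k delta C /\
  let M := (delta %/ k + ceil_div delta (n - k))%N in
  column_distance C M = ((n - k) * (delta %/ k + 1) + delta + 1)%N.

Definition sliding_parity_check r n (H : 'M[{poly F}]_(r, n)) (j : nat) :
    'M[F]_(\sum_(a < j.+1) r, \sum_(b < j.+1) n) :=
  \mxblock_(a < j.+1, b < j.+1)
    (if (b <= a)%N then map_mx (coefp (a - b)) H else 0).

Definition syndrome r n (H : 'M[{poly F}]_(r, n)) (M : nat)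
    (w : 'rV[laurent F]_n) (j : nat) : 'rV[F]_(\sum_(i < M.+1) r) :=
  window (w *m (map_mx (@lpoly F) H)^T) j%:Z M.

(* The condition imposed on eta_0 in the decoding step. *)
Definition error_candidate r n (H : 'M[{poly F}]_(r, n)) (M : nat)
    (S : 'rV[F]_(\sum_(i < M.+1) r)) (eta0 : 'rV[F]_n) : Prop :=
  exists eta : 'rV[F]_(\sum_(i < M.+1) n),
    [/\ S = eta *m (sliding_parity_check H M)^T,
        (2 * wt eta <= M.+1)%N & submxrow eta 0 = eta0].

(* The word after the cycle of index j. If no candidate exists the cycle leaves
   the word unchanged; if several exist it uses an arbitrary one. *)
Definition decoding_cycle r n (H : 'M[{poly F}]_(r, n)) (M j : nat)
    (w : 'rV[laurent F]_n) : 'rV[laurent F]_n :=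
  let eta0 := xget 0 (error_candidate H (syndrome H M w j)) in
  w - map_mx (fun a : F => lpoly (a *: 'X^j)) eta0.

(* The word before the cycle of index j, equivalently after j cycles. *)
Fixpoint decoded r n (H : 'M[{poly F}]_(r, n)) (M : nat)
    (w : 'rV[laurent F]_n) (j : nat) : 'rV[laurent F]_n :=
  if j is i.+1 then decoding_cycle H M i (decoded H M w i) else w.

End Codes.

(* Main.v *)
(* At the start of the j-th cycle the current word is v + e, where e is eps with
   the coefficients below j deleted. As v has zero syndrome and e has no
   coefficient below j, the j-th syndrome is eps_[j,j+M] (H^c_M)^T, so eps_j is
   a candidate. Two candidates eta, eta' differ by an element of ker (H^c_M)^T
   of weight at most M + 1. Since H has a polynomial right inverse, every
   element of that kernel is the initial window of a codeword; if
   eta_0 <> eta'_0 this codeword has delay 0, which contradicts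
   d^c_M = M + 2. *)

Require Import Defs.
From mathcomp Require Import all_boot all_order all_algebra.
From mathcomp Require Import boolp classical_sets constructive_ereal.
From HB Require Import structures.
From mathcomp Require Import fsbigop zify.

Set Implicit Arguments.
Unset Strict Implicit.
Unset Printing Implicit Defensive.

Import Order.TTheory GRing.Theory Num.Theory.
Local Open Scope classical_set_scope.
Local Open Scope ring_scope.

(** * Products of a Laurent series with a polynomial *)

Section LaurentCoefficients.
Variable R : comNzRingType.
Implicit Types (f : laurent R) (p q : {poly R}).

(** Terms below [m] vanish with [f], terms above [m + a] because [p] has no negative powers. A bound
    [N] independent of [a] gives all coefficients of a window one index range, as in a row of
    blocks. *)
Lemma lcoefM_poly f p (m : int) (N a : nat) : (forall i, i < m -> f i = 0) ->
  (a < N)%N ->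
  (f * lpoly p) (m + a%:Z) =
  \sum_(b < N) (if (b <= a)%N then f (m + b%:Z) * p`_(a - b) else 0).
Proof.
move=> fm aN; rewrite lcoefM.
pose r := [seq m + b%:Z | b <- index_iota 0 N].
have r_uniq : uniq r by rewrite map_inj_uniq ?iota_uniq // => x y /addrI[].
rewrite (fsbigE r) //.
  rewrite big_map (eq_bigl xpredT) => [|i]; last exact: in_setT.
  rewrite big_mkord; apply: eq_bigr => -[b /= bN] _.
  case: leqP => [ba|ab].
    by rewrite (_ : m + a%:Z - (m + b%:Z) = (a - b)%N%:Z); last lia.
  (* In the form [Negz], a negative index makes [lpoly] reduce to 0. *)
  rewrite (_ : m + a%:Z - (m + b%:Z) = Negz (b - a).-1); last lia.
  by rewrite mulr0.
move=> i _ /negP ir; have [im|mi] := ltP i m; first by rewrite fm // mul0r.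
have Ni : m + N%:Z <= i.
  rewrite leNgt; apply/negP => iN; apply: ir.
  by apply/mapP; exists `|i - m|%N; [rewrite mem_index_iota|]; lia.
rewrite (_ : m + a%:Z - i = Negz (`|i - m| - a).-1); last lia.
by rewrite mulr0.
Qed.

Lemma lcoefM_poly_lt f p (m j : int) : (forall i, i < m -> f i = 0) ->
  j < m -> (f * lpoly p) j = 0.
Proof.
move=> fm jm; rewrite (_ : j = j + 0%N%:Z); last by rewrite addr0.
rewrite (@lcoefM_poly _ _ _ 1) // => [|i ij]; last by rewrite fm // (lt_trans ij).
by rewrite big_ord1 /= addr0 fm // mul0r.
Qed.

(** The ring morphism structure transports a polynomial identity [H *m X = 1] to matrices of Laurent
    series. *)
Fact lpoly_is_zmod_morphism : zmod_morphism (@lpoly R).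
Proof.
move=> p q; apply/laurentP => -[i|i]; rewrite lcoefD lcoefN /= ?subr0 //.
by rewrite coefB.
Qed.

Fact lpoly_is_monoid_morphism : monoid_morphism (@lpoly R).
Proof.
split=> // p q; apply/laurentP => -[i|i].
  rewrite -[Posz i]add0r (@lcoefM_poly _ _ _ i.+1) // => [|[]//].
  rewrite add0r /= coefM.
  by apply: eq_bigr => -[b /=]; rewrite ltnS => bi _; rewrite bi.
by rewrite (@lcoefM_poly_lt _ _ 0) // => -[].
Qed.

HB.instance Definition _ := GRing.isZmodMorphism.Build {poly R} (laurent R)
  (@lpoly R) lpoly_is_zmod_morphism.
HB.instance Definition _ := GRing.isMonoidMorphism.Build {poly R} (laurent R)
  (@lpoly R) lpoly_is_monoid_morphism.

Lemma lcoef_sum (I : Type) (s : seq I) (G : I -> laurent R) j :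
  (\sum_(i <- s) G i) j = \sum_(i <- s) G i j.
Proof. by elim: s => [|i s IH]; rewrite ?big_nil ?big_cons ?lcoefD ?IH. Qed.

End LaurentCoefficients.

(** * Minima with a default value *)

Section Minimum.
Context {d : Order.disp_t} {T : porderType d}.
Implicit Types (A : set T) (x y : T).

Lemma minimum_eq x0 A x : A x -> lbound A x -> minimum x0 A = x.
Proof.
move=> Ax lx; apply: xget_unique => // y [Ay ly].
by apply: le_anti; rewrite ly // lx.
Qed.

(** A value other than the default certifies that the minimum is attained. *)
Lemma minimum_le x0 A y : minimum x0 A <> x0 -> A y -> (minimum x0 A <= y)%O.
Proof.
rewrite /minimum; case: xgetP => [x _ [_ lx] _|//]; exact: lx.
Qed.

End Minimum.

(** * Weights, windows and delays *)

Section Windows.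
Variables (F : fieldType) (n : nat).
Implicit Types (u v : 'rV[laurent F]_n).

Lemma wtB N (x y : 'rV[F]_N) : (wt (x - y) <= wt x + wt y)%N.
Proof.
rewrite /wt -cardUI; apply: leq_trans (leq_addr _ _); apply: subset_leq_card.
apply/fintype.subsetP => i; rewrite !inE !mxE; apply: contraR.
by rewrite negb_or !negbK => /andP[/eqP-> /eqP->]; rewrite subrr.
Qed.

Lemma vcoefD u v j : vcoef (u + v) j = vcoef u j + vcoef v j.
Proof. by apply/rowP => i; rewrite !mxE. Qed.

Lemma vcoefB u v j : vcoef (u - v) j = vcoef u j - vcoef v j.
Proof. by apply/rowP => i; rewrite !mxE. Qed.

Lemma vcoef_eq0P v j : vcoef v j = 0 <-> forall t, v 0 t j = 0.
Proof.
split=> [/rowP v0 t|v0]; first by have := v0 t; rewrite !mxE.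
by apply/rowP => t; rewrite !mxE v0.
Qed.

Lemma vcoef_monomial (a : 'rV[F]_n) (j : nat) (i : int) :
  vcoef (map_mx (fun c : F => lpoly (c *: 'X^j)) a) i =
  if i == j%:Z then a else 0.
Proof.
apply/rowP => t; rewrite !mxE; case: i => [i|i] /=; last by rewrite mxE.
by rewrite coefZ coefXn eqz_nat; case: eqP; rewrite ?mulr1 ?mulr0 ?mxE.
Qed.

Lemma eq_window u v m l :
  (forall i : nat, (i <= l)%N -> vcoef u (m + i%:Z) = vcoef v (m + i%:Z)) ->
  window u m l = window v m l.
Proof. by move=> uv; apply: eq_mxrow => i; rewrite uv // -ltnS. Qed.

Lemma delay_eq v (m : int) : vcoef v m != 0 ->
  (forall i, i < m -> vcoef v i = 0) -> delay v = m%:E.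
Proof.
move=> vm vlt; apply: minimum_eq; first by exists m.
move=> _ [i vi <-]; rewrite lee_fin leNgt; apply/negP => im.
by move/eqP: vi; apply; apply: vlt.
Qed.

Lemma vcoef_bound v : exists l : int, forall j, j < l -> vcoef v j = 0.
Proof.
have [l lP] : {l : 'I_n -> int & forall t j, j < l t -> v 0 t j = 0}.
  by apply: (@choice _ _ (fun t l => forall j, j < l -> v 0 t j = 0)) => t;
    apply: laurent_bound.
(* This lies below every [l t]. *)
exists (- \sum_t `|l t|) => j jl; apply/vcoef_eq0P => t; apply: lP.
apply: lt_le_trans jl _; rewrite lerNl; apply: le_trans (ler_norm _) _.
by rewrite normrN (bigD1 t) //= lerDl sumr_ge0.
Qed.

Lemma delay_ge0 v : (0%:E <= delay v)%E -> forall j, j < 0 -> vcoef v j = 0.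
Proof.
move=> dv j j0; apply/eqP; apply/negPn/negP => vj.
have [l vl] := vcoef_bound v.
have lj : l <= j by rewrite leNgt; apply/negP => /vl /eqP; apply/negP.
(* Offsets from [l] turn the search for the least nonzero coefficient into one over [nat]; its index
   is the delay and is at most [j < 0]. *)
have ex : exists k, vcoef v (l + k%:Z) != 0.
  by exists `|j - l|%N; rewrite (_ : l + _ = j) //; lia.
case: (ex_minnP ex) => k vk kmin.
have kj : l + k%:Z <= j.
  have: (k <= `|j - l|)%N by apply: kmin; rewrite (_ : l + _ = j) //; lia.
  lia.
move: dv; rewrite (delay_eq vk) ?lee_fin => [|i ilk]; first by lia.
have [/vl//|li] := ltP i l; apply/eqP/negPn/negP => vi.
have: (k <= `|i - l|)%N by apply: kmin; rewrite (_ : l + _ = i) //; lia.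
lia.
Qed.

Lemma column_distance_le (C : set 'rV[laurent F]_n) M v :
  column_distance C M != 0%N -> C v -> delay v = 0%:E ->
  (column_distance C M <= wt (window v 0 M))%N.
Proof.
move=> /eqP d0 Cv dv; have := @minimum_le _ _ 0%N _ (wt (window v 0 M)) d0.
by rewrite leEnat; apply; exists v.
Qed.

End Windows.

(** * Syndromes and the kernel of the sliding matrix *)

Section ParityCheck.
Variables (F : fieldType) (r n : nat) (H : 'M[{poly F}]_(r, n)).
Implicit Types (u v e : 'rV[laurent F]_n).
Local Notation Hl := (map_mx (@lpoly F) H).

Lemma vcoef_mul_poly_lt e (m j : int) : (forall i, i < m -> vcoef e i = 0) ->
  j < m -> vcoef (e *m Hl^T) j = 0.
Proof.
move=> em jm; apply/vcoef_eq0P => c; rewrite mxE lcoef_sum big1 // => t _.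
rewrite !mxE; apply: lcoefM_poly_lt jm => i im.
by have /vcoef_eq0P := em i im.
Qed.

(** As [e] starts at [j], no earlier coefficient enters the syndrome, so the truncated convolution
    is exactly the block triangular product. *)
Lemma syndrome_window e (M j : nat) :
  (forall i : int, i < j%:Z -> vcoef e i = 0) ->
  syndrome H M e j = window e j%:Z M *m (sliding_parity_check H M)^T.
Proof.
move=> ej; rewrite /syndrome /window /sliding_parity_check tr_mxblock.
rewrite mul_mxrow_mxblock; apply: eq_mxrow => a; apply/rowP => c.
rewrite !mxE lcoef_sum summxE.
under eq_bigr => t _.
  rewrite !mxE (@lcoefM_poly _ _ _ _ M.+1) //; last first.
    by move=> i ij; have /vcoef_eq0P := ej i ij.
  over.
rewrite exchange_big; apply: eq_bigr => b _; rewrite mxE.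
by apply: eq_bigr => t _; rewrite !mxE; case: leqP => _; rewrite !mxE ?mulr0.
Qed.

(* The correction term (x H^T) X^T, with X a right inverse of H, has no
   coefficient of index at most M. *)
Lemma sliding_kernel_codeword M (eta : 'rV[F]_(\sum_(i < M.+1) n)) :
  basic H -> eta *m (sliding_parity_check H M)^T = 0 ->
  exists v, [/\ v *m Hl^T = 0, forall i, i < 0 -> vcoef v i = 0 &
    window v 0 M = eta].
Proof.
move=> [X HX] eta0.
pose x : 'rV[laurent F]_n :=
  \row_t lpoly (\poly_(b < M.+1) submxrow eta (inord b) 0 t).
have xlt i : i < 0 -> vcoef x i = 0.
  by case: i => // i _; apply/vcoef_eq0P => t; rewrite mxE.
have wx : window x 0 M = eta.
  rewrite -[RHS]submxrowK; apply: eq_mxrow => b; apply/rowP => t.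
  by rewrite !mxE add0r /= coef_poly ltn_ord !mxE inord_val.
pose P := x *m Hl^T.
(* Negative coefficients vanish since [x] has none; those from 0 to [M] are the blocks of [eta0]. *)
have Plt i : i < M.+1%:Z -> vcoef P i = 0.
  case: i => [i|i] iM; last exact: vcoef_mul_poly_lt xlt _.
  have := syndrome_window M xlt; rewrite wx eta0 /syndrome => /mxrowP.
  move=> /(_ (Ordinal iM)); rewrite mxrowK add0r => ->.
  by apply/rowP => c; rewrite !mxE.
have Ylt i : i < M.+1%:Z -> vcoef (P *m (map_mx (@lpoly F) X)^T) i = 0.
  move=> iM; apply/vcoef_eq0P => c; rewrite mxE lcoef_sum big1 // => t _.
  rewrite [X in _ * X]mxE [X in _ * X]mxE; apply: lcoefM_poly_lt iM => k kM.
  by have /vcoef_eq0P := Plt k kM.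
exists (x - P *m (map_mx (@lpoly F) X)^T); split.
(* Transposing [H *m X = 1] shows that the correction term has the same syndrome [P] as [x]. *)
- by rewrite mulmxBl -mulmxA -trmx_mul -map_mxM HX map_mx1 trmx1 mulmx1 subrr.
- by move=> i i0; rewrite vcoefB xlt // Ylt ?subr0 //; lia.
- rewrite -wx; apply: eq_window => i iM; rewrite vcoefB Ylt ?subr0 //; lia.
Qed.

Lemma error_candidate_unique (C : set 'rV[laurent F]_n) M S (x y : 'rV[F]_n) :
  parity_check C H -> (M.+1 < column_distance C M)%N ->
  error_candidate H S x -> error_candidate (M := M) H S y -> x = y.
Proof.
move=> [Hb CH] dM [eta [Seta weta <-]] [eta' [Seta' weta' <-]].
have ker : (eta - eta') *m (sliding_parity_check H M)^T = 0.
  by rewrite mulmxBl -Seta -Seta' subrr.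
have [v [vH vlt wv]] := sliding_kernel_codeword Hb ker.
apply/eqP; rewrite -subr_eq0; apply/negPn/negP => nz.
have v0 : vcoef v 0 != 0.
  move/mxrowP: wv => /(_ 0); rewrite mxrowK add0r => ->.
  apply: contra nz => /eqP/rowP sub0; apply/eqP/rowP => t.
  by have := sub0 t; rewrite !mxE.
have : (column_distance C M <= wt (window v 0 M))%N.
  (* The bound [dM] also rules out the default value 0 of the column distance. *)
  apply: column_distance_le; first by rewrite -lt0n (leq_trans _ dM).
    by rewrite CH.
  exact: delay_eq.
have := wtB eta eta'; rewrite wv; lia.
Qed.

End ParityCheck.

(** * One decoding cycle and the loop invariant *)

Lemma decoding_cycle_correct (F : fieldType) r n (C : set 'rV[laurent F]_n)
    (H : 'M[{poly F}]_(r, n)) M j (v e : 'rV[laurent F]_n) :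
  parity_check C H -> (M.+1 < column_distance C M)%N -> C v ->
  (forall i : int, i < j%:Z -> vcoef e i = 0) ->
  (2 * wt (window e j%:Z M) <= M.+1)%N ->
  (exists! eta0, error_candidate H (syndrome H M (v + e) j) eta0) /\
  decoding_cycle H M j (v + e) =
    v + (e - map_mx (fun a : F => lpoly (a *: 'X^j)) (vcoef e j%:Z)).
Proof.
move=> HC dM Cv ej we.
have cand : error_candidate H (syndrome H M (v + e) j) (vcoef e j%:Z).
  exists (window e j%:Z M); split=> //; last by rewrite mxrowK addr0.
  rewrite -syndrome_window // /syndrome mulmxDl.
  by have [_ CE] := HC; move: Cv; rewrite CE => /= ->; rewrite add0r.
split.
  by exists (vcoef e j%:Z); split=> // y; apply: (error_candidate_unique HC dM).
(* Uniqueness forces the arbitrary choice in the cycle to be the true error coefficient. *)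
rewrite /decoding_cycle (xget_unique 0 cand) ?addrA // => y cy.
exact: (error_candidate_unique HC dM cy cand).
Qed.

Theorem theorem6p2 (F : finFieldType) (n delta : nat)
    (C : set 'rV[laurent F]_n) (H : 'M[{poly F}]_(1, n))
    (v vhat eps : 'rV[laurent F]_n) :
  let M := (delta %/ n.-1 + delta)%N in
  strongly_MDS n.-1 delta C ->
  parity_check C H ->
  C v ->
  vhat = v + eps ->
  (0%:E <= delay v)%E ->
  (0%:E <= delay vhat)%E ->
  (forall j : nat, (2 * wt (window eps j%:Z M) <= M.+1)%N) ->
  forall j : nat,
    (exists! eta0 : 'rV[F]_n,
      error_candidate H (syndrome H M (decoded H M vhat j) j) eta0) /\
    window (decoded H M vhat j.+1) 0 j = window v 0 j.
Proof.
move=> M [[/andP[k1 kn] _] dC] HC Cv vhatE dv dvhat weps j.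
have dM : (M.+1 < column_distance C M)%N.
  (* For codimension 1 the strongly MDS value is [M + 2]. *)
  move: dC; rewrite (_ : n - n.-1 = 1)%N; last lia.
  rewrite /ceil_div divn1 dvd1n addn0 -/M => ->; rewrite /M; lia.
have eps_lt0 (i : int) : i < 0 -> vcoef eps i = 0.
  move=> i0; rewrite (_ : eps = vhat - v); last by rewrite vhatE addrC addKr.
  by rewrite vcoefB !delay_ge0 // subrr.
have cycle k e : (forall i, vcoef e i = if i < k%:Z then 0 else vcoef eps i) ->
    (2 * wt (window e k%:Z M) <= M.+1)%N.
  (* The window starts at [k], where [e] still agrees with [eps]. *)
  move=> eE; rewrite (_ : window e _ _ = window eps k%:Z M) //.
  by apply: eq_window => i _; rewrite eE ifF //; lia.
have inv k : exists2 e : 'rV[laurent F]_n, decoded H M vhat k = v + e &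
    forall i, vcoef e i = if i < k%:Z then 0 else vcoef eps i.
  elim: k => [|k [e dE eE]].
    by exists eps => // i; case: ifP => // /eps_lt0.
  have elt i : i < k%:Z -> vcoef e i = 0 by move=> ik; rewrite eE ik.
  have [_ cE] := decoding_cycle_correct HC dM Cv elt (cycle k e eE).
  rewrite /= dE cE; eexists; first by [].
  (* The subtracted monomial clears coefficient [k] and leaves all others unchanged. *)
  move=> i; rewrite vcoefB vcoef_monomial; have [->|ik] := eqVneq i k%:Z.
    by rewrite subrr ifT //; lia.
  by rewrite subr0 eE (_ : (i < k.+1%:Z) = (i < k%:Z)) //; lia.
have [e dE eE] := inv j.
have [e' dE' eE'] := inv j.+1.
split.
  rewrite dE; apply: (decoding_cycle_correct HC dM Cv _ (cycle j e eE)).1.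
  by move=> i ij; rewrite eE ij.
(* After cycle [j] the invariant for [j.+1] applies, so the remaining error vanishes on 0 to [j]. *)
by rewrite dE'; apply: eq_window => i ij; rewrite vcoefD eE' ifT ?addr0 //; lia.
Qed.
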